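(* Let $X$ be a real random variable with mean $\mu=\mathrm E X>0$ and $\mathrm E X^2<\infty$, let $\rho>0$ and $u>0$, and set $$\delta:=\rho\,\frac{\mu}{\mathrm E X^2},\qquad u_0:=\frac{u}{\mathrm E X^2}.$$ Let $W=(W_t)_{t\ge0}$ be a standard Brownian motion started at $0$, let $\underline R:=\inf_{t\ge0}\,(u_0+W_t+\delta t)$, and for a real level $v$ let $$\kappa(v):=-\mathrm E\big(\underline R\mid \underline R\le v\big).$$ Then the capital requirement $\kappa(v)$ is independent of $u$, and $$\kappa(v)=-v+\frac{\mathrm E X^2}{2\rho\mu}.$$
   Context: The process $u_0+W_t+\delta t$ is called the limiting case of the risk process. It arises, as $\lambda\to\infty$, from the rescaled risk process $\frac{1}{\lambda\,\mathrm E X^2}\big(\lambda u+\lambda\mu(1+\rho)t-\sum_{j=1}^{N_t}X_j\big)$, where $N$ is a Poisson process with rate $\lambda$, the $X_j$ are iid claim sizes distributed as $X$, $\mu$ is the mean claim size, $\rho$ is the safety loading and $u$ is the initial capital. The quantity $\kappa(v)$ is the average capital required to recover the company after ruin at level $v$, that is, conditional on the infimum of the process being at most $v$.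
   Formalization: The level v is restricted to v ≤ u_0 (for independence of u, v ≤ both initial levels); for v > u_0 the infimum never exceeds u_0, so κ(v) = −u_0 + E X²/(2ρμ), which depends on u and contradicts the stated formula. *)

(* Defs.v *)
From HB Require Import structures.
From mathcomp Require Export all_boot all_order all_algebra.
From mathcomp Require Export all_classical all_reals all_analysis.

Set Implicit Arguments.
Unset Strict Implicit.
Unset Printing Implicit Defensive.

Import Order.TTheory GRing.Theory Num.Theory.
Import numFieldNormedType.Exports.

Local Open Scope classical_set_scope.
Local Open Scope ring_scope.

(* Mutual independence of finitely many random variables. Taking some of the
   [B i] to be [setT] gives the product rule for every subfamily. *)
Definition mutually_independent (R : realType) (d : measure_display)
    (T : measurableType d) (P : probability T R) (n : nat)
    (Y : 'I_n -> T -> R) : Prop :=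
  forall B : 'I_n -> set R, (forall i, measurable (B i)) ->
    P (\bigcap_(i in [set: 'I_n]) (Y i @^-1` B i)) =
    (\prod_(i < n) P (Y i @^-1` B i))%E.

(* The time axis is [0, +oo[: nothing is required of [W t] for [t < 0].
   The second argument of [normal_prob] is the standard deviation. *)
Definition standard_brownian_motion (R : realType) (d : measure_display)
    (T : measurableType d) (P : probability T R)
    (W : R -> {RV P >-> R}) : Prop :=
  [/\ {ae P, forall w, W 0 w = 0},
      (forall (n : nat) (t : nat -> R), 0 <= t 0%N ->
         (forall i : nat, (i < n)%N -> t i <= t i.+1) ->
         mutually_independent P
           (fun (i : 'I_n) w => W (t i.+1) w - W (t i) w)),
      (forall s t : R, 0 <= s -> s < t ->
         forall B : set R, measurable B ->
           P [set w | B (W t w - W s w)] =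
           normal_prob 0 (Num.sqrt (t - s)) B)
    & {ae P, forall w, {within `[0, +oo[, continuous (fun t => W t w)}}].

(* Extended-real valued, since a path may be unbounded below on a null set. *)
Definition infimum_with_drift (R : realType) (d : measure_display)
    (T : measurableType d) (P : probability T R) (W : R -> {RV P >-> R})
    (u0 delta : R) (w : T) : \bar R :=
  ereal_inf [set (u0 + W t w + delta * t)%:E | t in `[0, +oo[].

(* E[Y | A] = E[Y ; A] / P(A), where P(A) is written as E[1_A]: this is [P A]
   for measurable [A], and remains meaningful when [A] is measurable only up to
   a null set, as can happen when paths are continuous only almost surely. *)
Definition event_cond_expectation (R : realType) (d : measure_display)
    (T : measurableType d) (P : probability T R) (Y : T -> \bar R)
    (A : set T) : \bar R :=
  ((\int[P]_(w in A) Y w) / 'E_P[\1_A])%E.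

Definition capital_requirement (R : realType) (d : measure_display)
    (T : measurableType d) (P : probability T R) (W : R -> {RV P >-> R})
    (u0 delta v : R) : \bar R :=
  let Rinf := infimum_with_drift W u0 delta in
  (- event_cond_expectation P Rinf [set w | Rinf w <= v%:E])%E.

(* Main.v *)
(* With S_t := W_t + delta t, the process exp (- 2 delta S_t) is a martingale.
   Stopping it on a finite grid of mesh h at the first passage below - x, the
   overshoot is smaller than e up to an error of order n exp (- n^(1/2) e) and
   the mass surviving up to time n h is O(exp (- delta^2 n h / 2)); so refining
   the grid and then extending it gives P (inf S <= - x) = exp (- 2 delta x).
   Hence, given inf (u0 + S) <= v, the depth v - inf (u0 + S) is exponential
   with mean 1 / (2 delta), whatever u0. *)
From HB Require Import structures.
Require Import Defs.
From mathcomp Require Import ring lra measurable_realfun.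

Set Implicit Arguments.
Unset Strict Implicit.
Unset Printing Implicit Defensive.

Import Order.TTheory GRing.Theory Num.Theory.
Import numFieldNormedType.Exports.

Local Open Scope classical_set_scope.
Local Open Scope ring_scope.

(** * Integrals and independence *)

(** An overshoot only enlarges [exp (- 2 delta S)] at the passage, so the upper bound on the
    crossing probability holds on every single grid; only the lower bound has to control overshoots
    and needs a limit. For it, an extra tilt [l] gains a factor [exp (- l e)] at each step and costs
    [exp] of a quantity of order [l ^ 2 h]. With [n = m ^ 2] steps of length [h = T0 / m ^ 2] and
    [l = m] the cost stays bounded, whence the order [n exp (- n^(1/2) e)]. A second obstacle is
    measurability: as paths are continuous only almost surely, the infimum over all times may fail
    to be measurable. Its law is found for an infimum over countably many times and carried over by
    integrals that ignore null sets even for nonmeasurable integrands. *)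

Section lower_integral.
Import HBNNSimple.

(* [f] and [g] need not be measurable: the integral is then a supremum over the
   simple functions below the integrand, and cutting such a function down to 0
   on a null set does not change its integral. *)
Lemma ge0_ae_le_integral d (T : measurableType d) (R : realType)
   (mu : {measure set T -> \bar R}) (f g : T -> \bar R) :
  (forall x, 0 <= f x)%E -> (forall x, 0 <= g x)%E ->
  {ae mu, forall x, f x = g x} ->
  (\int[mu]_x f x <= \int[mu]_x g x)%E.
Proof.
move=> f0 g0 [N [mN N0 sub]].
rewrite !ge0_integralTE//.
apply: ge_ereal_sup => _ [h /= hf <-].
pose k := proj_nnsfun h (measurableC mN).
apply: ereal_sup_ubound; exists k => /=.
  move=> x; rewrite mindicE; have [xN|xN] := boolP (x \in ~` N).
    rewrite mulr1; suff <- : f x = g x by [].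
    by apply: contrapT => fgx; move: xN; rewrite inE; apply; exact: sub.
  by rewrite mulr0.
suff: sintegral mu k = sintegral mu h by [].
rewrite -(integralT_nnsfun mu k) -(integralT_nnsfun mu h).
apply: ge0_ae_eq_integral => //.
- exact/measurable_EFinP.
- exact/measurable_EFinP.
- by move=> x _; rewrite lee_fin.
- by move=> x _; rewrite lee_fin.
exists N; split => // x /= /not_implyP[_] kh; apply: contrapT => nNx; apply: kh.
by rewrite mindicE mem_set ?mulr1.
Qed.

Lemma ae_eq_integralT d (T : measurableType d) (R : realType)
   (mu : {measure set T -> \bar R}) (f g : T -> \bar R) :
  {ae mu, forall x, f x = g x} ->
  (\int[mu]_x f x = \int[mu]_x g x)%E.
Proof.
move=> fg; rewrite integralE [RHS]integralE.
congr (_ - _)%E; apply/eqP; rewrite eq_le; apply/andP; split;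
  apply: ge0_ae_le_integral => //;
  by apply: filterS fg => x /=; rewrite ?funeposE ?funenegE => ->.
Qed.

End lower_integral.

(** The Radon-Nikodym derivative of [normal_prob m s] and [normal_pdf m s] have the same integral
    over every measurable set, so they agree almost everywhere and either serves as density. *)
Lemma ge0_integral_normal_prob (R : realType) (m s : R) (f : R -> \bar R) :
  measurable_fun setT f -> (forall x, 0 <= f x)%E ->
  (\int[normal_prob m s]_x f x =
   \int[lebesgue_measure]_x (f x * (normal_pdf m s x)%:E))%E.
Proof.
move=> mf f0.
have dom := normal_prob_dominates m s.
rewrite -(Radon_Nikodym_SigmaFinite.change_of_variables dom)//.
apply: ae_eq_integral => //=.
- apply: emeasurable_funM => //.
  exact: measurable_int (Radon_Nikodym_SigmaFinite.f_integrable dom).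
- apply: emeasurable_funM => //; apply/measurable_EFinP.
  exact: measurable_normal_pdf.
- apply: ae_eqe_mul2l; apply: integral_ae_eq => //=.
  + exact: Radon_Nikodym_SigmaFinite.f_integrable.
  + apply/measurable_EFinP; exact: measurable_normal_pdf.
  + by move=> E _ mE; rewrite -Radon_Nikodym_SigmaFinite.f_integral.
Qed.

Lemma normal_prob_mgf (R : realType) (s a : R) : s != 0 ->
  (\int[normal_prob 0 s]_x (expR (a * x))%:E = (expR (a ^+ 2 * s ^+ 2 / 2))%:E)%E.
Proof.
move=> s0; rewrite ge0_integral_normal_prob; last 2 first.
- by apply/measurable_EFinP; exact: measurableT_comp.
- by move=> x; rewrite lee_fin expR_ge0.
under eq_integral => x _.
  rewrite (_ : (_ * _)%E =
    ((expR (a ^+ 2 * s ^+ 2 / 2))%:E * (normal_pdf (a * s ^+ 2) s x)%:E)%E); last first.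
    (* completing the square *)
    rewrite -!EFinM !normal_pdfE// /normal_fun; congr EFin.
    by rewrite mulrCA [RHS]mulrCA -!expRD; congr (_ * expR _); field.
  over.
rewrite ge0_integralZl//; last 2 first.
- by apply/measurable_EFinP; exact: measurable_normal_pdf.
- by move=> x _; rewrite lee_fin normal_pdf_ge0.
by rewrite integral_normal_pdf mule1.
Qed.

Section independence.
Local Open Scope ereal_scope.
Context d (T : measurableType d) (R : realType) (P : probability T R).
Variables (G : set (set T)) (V : T -> R).
Hypotheses (mG : G `<=` measurable) (setIG : setI_closed G) (GT : G setT).
Hypothesis mV : measurable_fun setT V.
Hypothesis indepGV : forall A B, G A -> measurable B ->
  P (A `&` V @^-1` B) = P A * P (V @^-1` B).

Let sG := g_sigma_algebraType G.

Let msG A : <<s G >> A -> measurable A.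
Proof. by apply: smallest_sub => //; exact: sigma_algebra_measurable. Qed.

Let mid : measurable_fun setT (id : T -> sG).
Proof. by move=> _ A mA; rewrite setTI preimage_id; exact: msG. Qed.

(** For fixed [B] both sides are finite measures in [A]: a restriction of [P] and a multiple of [P].
    They agree on the pi-system [G], hence on the sigma-algebra it generates. *)
Lemma independent_generated A B : <<s G >> A -> measurable B ->
  P (A `&` V @^-1` B) = P A * P (V @^-1` B).
Proof.
move=> sA mB.
have mVB : measurable (V @^-1` B) by rewrite -[X in measurable X]setTI; exact: mV.
pose r : {nonneg R} := NngNum (fine_ge0 (measure_ge0 P (V @^-1` B))).
have rE : (r%:num)%:E = P (V @^-1` B) by rewrite /= fineK// fin_num_measure.
rewrite muleC -rE; change (mrestr P mVB A = mscale r P A).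
apply: (g_sigma_algebra_measure_unique G mG (fun=> setT)) => //.
- by rewrite bigcup_const.
- by move=> C GC /=; rewrite /mrestr /mscale/= indepGV// muleC fineK// fin_num_measure.
- by move=> k /=; rewrite /mrestr setTI (le_lt_trans (probability_le1 _ _))// ltry.
Qed.

(** The identity, viewed as a random variable with values in the coarser space [sG], carries all the
    information of [G]. By independence the joint law of this variable and [V] is a product measure,
    and Tonelli's theorem factors the integral. *)
Lemma independent_ge0_integralM (f : T -> \bar R) (g : R -> \bar R) :
  measurable_fun setT (f : sG -> \bar R) -> measurable_fun setT g ->
  (forall x, 0 <= f x) -> (forall x, 0 <= g x) ->
  \int[P]_w (f w * g (V w)) = \int[P]_w f w * \int[P]_w g (V w).
Proof.
move=> mf mg f0 g0.
pose i : {mfun T >-> sG} := HB.pack (id : T -> sG) (isMeasurableFun.Build _ _ _ _ _ mid).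
pose v : {mfun T >-> R} := HB.pack V (isMeasurableFun.Build _ _ _ _ _ mV).
pose p (w : T) : sG * R := (w, V w).
have miv : measurable_fun setT p by apply/measurable_fun_pairP; split.
pose iv : {mfun T >-> (sG * R)%type} := HB.pack p
  (isMeasurableFun.Build _ _ _ _ _ miv).
pose h (z : sG * R) := f z.1 * g z.2.
have mh : measurable_fun setT h.
  by apply: emeasurable_funM; exact: measurableT_comp.
have h0 z : 0 <= h z by exact: mule_ge0.
transitivity (\int[distribution P iv]_z h z).
  by rewrite ge0_integral_distribution.
transitivity (\int[distribution P i \x distribution P v]_z h z).
  apply: eq_measure_integral => A mA _; apply/esym.
  apply: product_measure_unique => // B C mB mC.
  by rewrite -[RHS]independent_generated.
rewrite fubini_tonelli1// /fubini_F.
rewrite -[X in X * _](@ge0_integral_distribution _ _ _ _ _ P i f)//.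
rewrite -[X in _ * X](@ge0_integral_distribution _ _ _ _ _ P v g)//.
rewrite -ge0_integralZr//; last exact: integral_ge0.
by apply: eq_integral => x _; rewrite -ge0_integralZl.
Qed.

End independence.

(** * First passage of a random walk *)

Section walk.
Context (R : realType) (U : Type).
Implicit Types (xi : nat -> U -> R) (x : R) (k : nat).

Definition walk xi k (w : U) : R := \sum_(i < k) xi i w.

Lemma walkS xi k w : walk xi k.+1 w = walk xi k w + xi k w.
Proof. by rewrite /walk big_ord_recr. Qed.

Definition above xi x k : set U :=
  [set w | forall j, (j <= k)%N -> - x < walk xi j w].

Lemma aboveS xi x k :
  above xi x k.+1 = above xi x k `&` [set w | - x < walk xi k.+1 w].
Proof.
apply/seteqP; split => [w h|w [h1 h2] j].
  by split => [j jk|]; apply: h => //; exact: leqW.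
by rewrite leq_eqVlt => /predU1P[-> //|]; exact: h1.
Qed.

Lemma above0 xi x : 0 < x -> above xi x 0 = setT.
Proof.
move=> x0; apply/seteqP; split => // w _ j; rewrite leqn0 => /eqP ->.
by rewrite /walk big_ord0 oppr_lt0.
Qed.

End walk.

Section measurable_walk.
Context (R : realType) d (U : measurableType d).

Lemma measurable_walk (xi : nat -> U -> R) k :
  (forall i, (i < k)%N -> measurable_fun setT (xi i)) ->
  measurable_fun setT (walk xi k).
Proof.
elim: k => [_|k ih mxi].
  rewrite (_ : walk xi 0 = cst 0)//; apply/funext => w.
  by rewrite /walk big_ord0.
rewrite (_ : walk xi k.+1 = walk xi k \+ xi k); last first.
  by apply/funext => w; rewrite walkS.
by apply: measurable_funD; [apply: ih => i ik; apply: mxi; exact: leqW|exact: mxi].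
Qed.

Lemma measurable_above (xi : nat -> U -> R) x k :
  (forall i, (i < k)%N -> measurable_fun setT (xi i)) ->
  measurable (above xi x k).
Proof.
have mgt j : measurable_fun setT (walk xi j) ->
    measurable [set w | - x < walk xi j w].
  move=> mw; rewrite -[X in measurable X]setTI.
  rewrite (_ : [set w | _] = walk xi j @^-1` `]- x, +oo[).
    exact: mw.
  by apply/seteqP; split => w /=; rewrite in_itv/= andbT.
elim: k => [_|k ih mxi].
  rewrite (_ : above _ _ _ = [set w | - x < walk xi 0 w]).
    by apply: mgt; exact: measurable_walk.
  apply/seteqP; split => w; first exact.
  by move=> h j; rewrite leqn0 => /eqP ->.
rewrite aboveS; apply: measurableI.
  by apply: ih => i ik; apply: mxi; exact: leqW.
by apply: mgt; exact: measurable_walk.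
Qed.

End measurable_walk.

(** * Optional stopping of the exponential martingale *)

Section exponential_martingale.
Context d (T : measurableType d) (R : realType) (P : probability T R).
Variables (xi : nat -> T -> R) (c : R).
Hypothesis mxi : forall k, measurable_fun setT (xi k).
Hypothesis indep_xi : forall n, mutually_independent P (fun i : 'I_n => xi i).

(* A pi-system generating the sigma-algebra of the first [k] steps. *)
Definition past (k : nat) : set (set T) :=
  [set A | exists2 B : nat -> set R, (forall i, measurable (B i)) &
    A = [set w | forall i, (i < k)%N -> B i (xi i w)]].

Lemma pastE (B : nat -> set R) k :
  [set w | forall i, (i < k)%N -> B i (xi i w)] =
  \bigcap_(i in [set: 'I_k]) (xi i @^-1` B i).
Proof.
apply/seteqP; split => w h i => [_|ik]; first exact: h.
by have := h (Ordinal ik) I.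
Qed.

Lemma measurable_past k : past k `<=` measurable.
Proof.
move=> _ [B mB ->]; rewrite pastE; apply: fin_bigcap_measurable => // i _.
by rewrite -[X in measurable X]setTI; exact: mxi.
Qed.

Lemma past_setI_closed k : setI_closed (past k).
Proof.
move=> _ _ [B mB ->] [C mC ->]; exists (fun i => B i `&` C i).
  by move=> i; exact: measurableI.
apply/seteqP; split => w.
  by move=> [h1 h2] i ik; split; [exact: h1|exact: h2].
by move=> h; split=> i ik; have [] := h _ ik.
Qed.

Lemma past_setT k : past k setT.
Proof. by exists (fun=> setT) => //; apply/seteqP; split. Qed.

Lemma past_independent k A C : past k A -> measurable C ->
  P (A `&` xi k @^-1` C) = (P A * P (xi k @^-1` C))%E.
Proof.
move=> [B mB ->] mC; rewrite pastE indep_xi//.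
(* The constraints on the first [k] steps followed by [C] on step [k]: the product rule for [k.+1]
   variables then splits off its last factor. *)
pose D i := if (i < k)%N then B i else C.
have mD i : measurable (D i) by rewrite /D; case: ifP.
have := @indep_xi k.+1 (fun i => D i) (fun i => mD i).
have Dk : D k = C by rewrite /D ltnn.
rewrite big_ord_recr /= Dk => h.
transitivity (P (\bigcap_(i in [set: 'I_k.+1]) xi i @^-1` D i)).
  congr (P _); rewrite -!pastE; apply/seteqP; split => w.
    move=> [h1 h2] i; rewrite ltnS leq_eqVlt /D.
    by case: ltnP => [ik _|_ /orP[/eqP->|//]]; [exact: h1|].
  move=> h1; split => [i ik|].
    by have := h1 _ (leqW ik); rewrite /D ik.
  by have := h1 _ (leqnn _); rewrite /D ltnn.
rewrite h; congr (_ * _)%E; apply: eq_bigr => i _.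
by rewrite /D ltn_ord.
Qed.

Lemma measurable_past_xi k i : (i < k)%N ->
  measurable_fun setT (xi i : g_sigma_algebraType (past k) -> R).
Proof.
move=> ik _ B mB; rewrite setTI; apply: sub_sigma_algebra.
exists (fun j => if j == i then B else setT).
  by move=> j; case: ifP.
apply/seteqP; split => w /=.
  by move=> h j jk; case: eqP => // ->.
by move=> /(_ _ ik); rewrite eqxx.
Qed.

Hypothesis mgf1 : forall k, (\int[P]_w (expR (- c * xi k w))%:E = 1)%E.

(** The unstopped part in optional stopping; equivalently, the probability of surviving [k] steps
    under the law tilted by the density [expR (- c * walk xi k w)]. *)
Definition survival_mass x k : \bar R :=
  (\int[P]_w (expR (- c * walk xi k w) * \1_(above xi x k) w)%:E)%E.

(** The martingale property: step [k] is independent of the past, which decides [above xi x k], and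
    its exponential has mean 1 by [mgf1]. *)
Lemma survival_mass_step x k : survival_mass x k =
  (\int[P]_w (expR (- c * walk xi k.+1 w) * \1_(above xi x k) w)%:E)%E.
Proof.
pose f w := (expR (- c * walk xi k w) * \1_(above xi x k) w)%:E.
pose g y := (expR (- c * y))%:E.
transitivity (\int[P]_w (f w * g (xi k w)))%E; last first.
  apply: eq_integral => w _; rewrite /f /g -EFinM; congr EFin.
  by rewrite walkS mulrDr expRD mulrAC.
rewrite (@independent_ge0_integralM _ _ _ P (past k))//.
- by rewrite /g mgf1 mule1.
- exact: measurable_past.
- exact: past_setI_closed.
- exact: past_setT.
- exact: past_independent.
- apply/measurable_EFinP; apply: measurable_funM.
    apply: measurableT_comp => //; apply: measurable_funM => //.
    by apply: measurable_walk => i; exact: measurable_past_xi.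
  apply: measurable_indic; apply: measurable_above => i.
  exact: measurable_past_xi.
- by apply/measurable_EFinP; exact: measurableT_comp.
- by move=> w; rewrite lee_fin mulr_ge0 ?expR_ge0.
- by move=> y; rewrite lee_fin expR_ge0.
Qed.

Lemma survival_mass0 x : 0 < x -> survival_mass x 0 = 1%E.
Proof.
move=> x0; rewrite /survival_mass above0//.
under eq_integral do rewrite /walk big_ord0 mulr0 expR0 mul1r.
by rewrite integral_indic// setIT; exact: probability_setT.
Qed.

(** The first passage occurs at step [k.+1], not at step [k]. *)
Definition hit x k : set T := above xi x k `\` above xi x k.+1.

Lemma measurable_hit x k : measurable (hit x k).
Proof. by apply: measurableD; exact: measurable_above. Qed.

(** One step of optional stopping: after the martingale step, the mass splits into paths stopped now
    and paths still running. *)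
Lemma survival_massS x k : (survival_mass x k =
  \int[P]_w (expR (- c * walk xi k.+1 w) * \1_(hit x k) w)%:E +
  survival_mass x k.+1)%E.
Proof.
have mE : measurable_fun setT (fun w => expR (- c * walk xi k.+1 w)).
  apply: measurableT_comp => //; apply: measurable_funM => //.
  exact: measurable_walk.
rewrite survival_mass_step -ge0_integralD//.
- apply: eq_integral => w _; rewrite -EFinD -mulrDr; congr (_ * _)%:E.
  have [h1|h1] := pselect (above xi x k.+1 w).
    rewrite !indicE (memNset (A := hit x k)); last by move=> [_]; exact.
    by rewrite add0r !mem_set//; move: h1; rewrite aboveS => -[].
  rewrite !indicE (memNset h1) addr0.
  have [h2|h2] := pselect (above xi x k w); first by rewrite !mem_set.
  by rewrite !memNset// => -[].
- apply/measurable_EFinP; apply: measurable_funM => //.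
  apply: measurable_indic; exact: measurable_hit.
- apply/measurable_EFinP; apply: measurable_funM => //.
  apply: measurable_indic; exact: measurable_above.
Qed.

Lemma survival_mass_ge0 x k : (0 <= survival_mass x k)%E.
Proof. by apply: integral_ge0 => w _; rewrite lee_fin mulr_ge0// expR_ge0. Qed.

Lemma measure_not_aboveS x k : P (~` above xi x k.+1) =
  (P (~` above xi x k) + P (hit x k))%E.
Proof.
rewrite -measureU//; last 3 first.
- by apply: measurableC; exact: measurable_above.
- exact: measurable_hit.
- by apply/seteqP; split => // w [h [] /h].
congr (P _); apply/seteqP; split => w; rewrite /hit.
  by move=> h; have [h1|h1] := pselect (above xi x k w); [right|left].
by move=> [h|[]//] /=; rewrite aboveS => -[].
Qed.

End exponential_martingale.

(** * Upper and lower bounds for the crossing probability *)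

Section crossing_bounds.
Context d (T : measurableType d) (R : realType) (P : probability T R).
Variables (xi : nat -> T -> R) (c x : R).
Hypothesis mxi : forall k, measurable_fun setT (xi k).
Hypothesis indep_xi : forall n, mutually_independent P (fun i : 'I_n => xi i).
Hypothesis mgf1 : forall k, (\int[P]_w (expR (- c * xi k w))%:E = 1)%E.
Hypotheses (c_gt0 : 0 < c) (x_gt0 : 0 < x).

Let mexp (a : R) k : measurable_fun setT (fun w => expR (a * walk xi k w)).
Proof.
apply: measurableT_comp => //; apply: measurable_funM => //.
exact: measurable_walk.
Qed.

Let hit_walk k w : hit xi x k w -> walk xi k.+1 w <= - x < walk xi k w.
Proof.
move=> [h1 h2]; apply/andP; split; last exact: h1.
by rewrite leNgt; apply/negP => h3; apply: h2; rewrite aboveS.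
Qed.

Lemma crossing_probability_le n : (P (~` above xi x n) <= (expR (- (c * x)))%:E)%E.
Proof.
(* The survival term makes the induction work: the left side equals the bound at [n = 0] and never
   increases, because at a passage [walk <= - x], so each unit of crossing probability uses up at
   least [expR (c * x)] of mass. *)
suff h : (P (~` above xi x n) +
    (expR (- (c * x)))%:E * survival_mass P xi c x n <= (expR (- (c * x)))%:E)%E.
  apply: le_trans h; rewrite leeDl// mule_ge0 ?lee_fin ?expR_ge0//.
  exact: survival_mass_ge0.
elim: n => [|n ih].
  by rewrite above0// setCT measure0 add0e survival_mass0// mule1.
apply: le_trans ih; rewrite (survival_massS mxi indep_xi mgf1 x n).
rewrite (measure_not_aboveS _ mxi) -addeA leeD2l//.
have i0 : (0 <= \int[P]_w (expR (- c * walk xi n.+1 w) * \1_(hit xi x n) w)%:E)%E.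
  by apply: integral_ge0 => w _; rewrite lee_fin mulr_ge0// expR_ge0.
rewrite [leRHS]ge0_muleDr ?survival_mass_ge0//.
rewrite leeD2r// -ge0_integralZl//; last first.
- apply/measurable_EFinP; apply: measurable_funM => //.
  by apply: measurable_indic; exact: measurable_hit.
rewrite -[X in (P X <= _)%E]setIT -integral_indic//; last exact: measurable_hit.
apply: ge0_le_integral => //.
- by apply/measurable_EFinP; apply: measurable_indic; exact: measurable_hit.
- apply/measurable_EFinP; do 2! apply: measurable_funM => //.
  by apply: measurable_indic; exact: measurable_hit.
move=> w _; rewrite -EFinM lee_fin indicE.
have [|_] := boolP (w \in _); last by rewrite !mulr0.
rewrite inE => /hit_walk/andP[wx _].
rewrite !mulr1 -expRD -[leLHS]expR0 ler_expR.
by have := ler_wpM2l (ltW c_gt0) wx; nra.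
Qed.

(** Of the two equal halves of the exponent [- c * walk], one is bounded by survival, which gives
    [walk > - x]; the other is kept because its expectation decays. *)
Lemma survival_mass_le n :
  (survival_mass P xi c x n <=
   (expR (c / 2 * x))%:E * \int[P]_w (expR (- (c / 2) * walk xi n w))%:E)%E.
Proof.
rewrite -ge0_integralZl//; last first.
- exact/measurable_EFinP.
apply: ge0_le_integral => //.
- apply/measurable_EFinP; apply: measurable_funM => //.
  by apply: measurable_indic; exact: measurable_above.
- by apply/measurable_EFinP; apply: measurable_funM.
move=> w _; rewrite -EFinM lee_fin indicE.
have [|_] := boolP (w \in _); last by rewrite mulr0 mulr_ge0 ?expR_ge0.
rewrite inE => /(_ n (leqnn _)) wx.
rewrite mulr1; have := ler_wpM2l (ltW c_gt0) (ltW wx).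
by rewrite -expRD ler_expR; nra.
Qed.

(* The last term bounds the mass carried by overshoots larger than [e]: such an
   overshoot forces a step [xi k < - e], and the indicator of that event is at
   most [expR (- l * (xi k + e))]. *)
Lemma crossing_probability_ge (e l M : R) n : 0 <= l ->
  (forall k, (\int[P]_w (expR (- (c + l) * xi k w))%:E = M%:E)%E) ->
  (1 <= (expR (c * (x + e)))%:E * P (~` above xi x n) +
        survival_mass P xi c x n + (n%:R * (expR (c * x - l * e) * M))%:E)%E.
Proof.
move=> l0 mgfM; elim: n => [|n ih].
  by rewrite survival_mass0// above0// setCT measure0 mule0 add0e mul0r adde0.
apply: (le_trans ih); rewrite (survival_massS mxi indep_xi mgf1 x n).
rewrite (measure_not_aboveS _ mxi).
rewrite [((expR (c * (x + e)))%:E * (_ + _))%E]ge0_muleDr//.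
rewrite -natr1 mulrDl mul1r EFinD.
have regroup (p q m z y : \bar R) : (p + q + m + (z + y) = p + (q + y + m) + z)%E.
  by rewrite [(z + y)%E]addeC addeA -!addeA [(m + (y + z))%E]addeCA.
rewrite regroup leeD2r// leeD2l// leeD2r//.
rewrite EFinM -(mgfM n) -ge0_integralZl//; last first.
- apply/measurable_EFinP; apply: measurableT_comp => //; exact: measurable_funM.
rewrite -[X in (_ <= _ * P X + _)%E]setIT -integral_indic//; last exact: measurable_hit.
rewrite -ge0_integralZl//; last first.
- by apply/measurable_EFinP; apply: measurable_indic; exact: measurable_hit.
have m1 : measurable_fun setT
    (fun w => (expR (c * (x + e)))%:E * (\1_(hit xi x n) w)%:E)%E.
  apply/measurable_EFinP; apply: measurable_funM => //.
  by apply: measurable_indic; exact: measurable_hit.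
have m2 : measurable_fun setT
    (fun w => (expR (c * x - l * e))%:E * (expR (- (c + l) * xi n w))%:E)%E.
  apply/measurable_EFinP; apply: measurable_funM => //.
  by apply: measurableT_comp => //; exact: measurable_funM.
rewrite -ge0_integralD//.
apply: ge0_le_integral => //.
- apply/measurable_EFinP; apply: measurable_funM => //.
  by apply: measurable_indic; exact: measurable_hit.
- exact: emeasurable_funD.
move=> w _; rewrite -!EFinM -EFinD lee_fin indicE.
have [|_] := boolP (w \in _); last by rewrite !mulr0 add0r mulr_ge0 ?expR_ge0.
rewrite inE => /hit_walk/andP[wx xw]; rewrite !mulr1.
have [we|we] := leP (- x - e) (walk xi n.+1 w).
  have h := ler_wpM2l (ltW c_gt0) we.
  apply: (@le_trans _ _ (expR (c * (x + e)))); first by rewrite ler_expR; lra.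
  by rewrite lerDl mulr_ge0 ?expR_ge0.
rewrite (@le_trans _ _ (expR (c * x - l * e) * expR (- (c + l) * xi n w)))//; last first.
  by rewrite lerDr expR_ge0.
rewrite -expRD ler_expR; rewrite walkS in wx we *.
have h1 := ler_wpM2l (ltW c_gt0) (ltW xw).
have h2 : l * xi n w <= l * - e by apply: ler_wpM2l => //; lra.
by nra.
Qed.

End crossing_bounds.

(** * Brownian motion with drift on a grid *)

Lemma le_of_expR_scale (R : realType) (a A p : R) : 0 < a -> 0 < A ->
  (forall e, 0 < e -> A <= expR (a * e) * p) -> A <= p.
Proof.
move=> a0 A0 key.
have p_gt0 : 0 < p.
  rewrite -(pmulr_rgt0 _ (expR_gt0 (a * 1))).
  exact: lt_le_trans A0 (key _ ltr01).
rewrite leNgt; apply/negP => pA.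
(* The choice [e := ln r / a] turns the factor into [r], halfway between 1 and [A / p], and the
   hypothesis into [A <= (A + p) / 2], contradicting [p < A]. *)
pose r := (A / p + 1) / 2.
have r1 : 1 < r by rewrite /r ltr_pdivlMr// mul1r ltrD2r ltr_pdivlMr// mul1r.
have e_gt0 : 0 < ln r / a by rewrite divr_gt0 ?ln_gt0.
have := key _ e_gt0.
rewrite mulrCA divff ?gt_eqF// mulr1 lnK ?posrE ?(lt_trans ltr01)//.
have -> : r * p = (A + p) / 2 by rewrite /r; field; rewrite gt_eqF.
by lra.
Qed.

(** Meant for [y = m * e]: cubic growth beats the [m ^ 2] steps of the grid and leaves a factor
    [1 / m]. *)
Lemma expR_ge_cube (R : realType) (y : R) : 0 <= y -> (y / 3) ^+ 3 <= expR y.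
Proof.
move=> y0; have -> : expR y = expR (y / 3) ^+ 3.
  by rewrite -expRM_natl; congr expR; field.
apply: lerXn2r; rewrite ?nnegrE ?expR_ge0 ?divr_ge0//.
by apply: le_trans (expR_ge1Dx _); rewrite lerDr.
Qed.

Section drifted_increments.
Context (R : realType) d (T : measurableType d) (P : probability T R).
Variables (W : R -> {RV P >-> R}) (delta : R).
Hypothesis hW : standard_brownian_motion W.
Hypothesis delta_gt0 : 0 < delta.

Lemma brownian_increment_mgf (s t a : R) : 0 <= s -> s < t ->
  (\int[P]_w (expR (a * (W t w - W s w)))%:E =
   (expR (a ^+ 2 * (t - s) / 2))%:E)%E.
Proof.
move=> s0 st; case: hW => _ _ law _.
(* [normal_prob] is a measure on [measurableTypeR R], whose display is not the
   one of the measurable structure of [R] carried by random variables. *)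
have mX : measurable_fun setT (W t \- W s : T -> measurableTypeR R).
  exact: (@measurable_funB _ _ R setT (W t) (W s)).
pose X : {RV P >-> measurableTypeR R} := HB.pack (W t \- W s : T -> measurableTypeR R)
  (isMeasurableFun.Build _ _ _ _ _ mX).
pose f (y : R) := (expR (a * y))%:E.
have ts : 0 < t - s by rewrite subr_gt0.
transitivity (\int[distribution P X]_y f y)%E.
  rewrite ge0_integral_distribution//.
    by apply/measurable_EFinP; exact: measurableT_comp.
  by move=> y; rewrite lee_fin expR_ge0.
transitivity (\int[normal_prob 0 (Num.sqrt (t - s))]_y f y)%E.
  by apply: eq_measure_integral => A mA _; exact: law.
rewrite normal_prob_mgf ?sqr_sqrtr ?ltW//.
by rewrite gt_eqF// sqrtr_gt0.
Qed.

Definition drifted_increment (h : R) (k : nat) (w : T) : R :=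
  W (k.+1%:R * h) w - W (k%:R * h) w + delta * h.

Lemma walk_drifted_increment h k w : walk (drifted_increment h) k w =
  W (k%:R * h) w - W 0 w + delta * (k%:R * h).
Proof.
elim: k => [|k ih]; first by rewrite /walk big_ord0 !mul0r subrr mulr0 add0r.
rewrite walkS ih /drifted_increment -natr1; ring.
Qed.

Lemma measurable_drifted_increment h k :
  measurable_fun setT (drifted_increment h k).
Proof.
apply: measurable_funD => //; exact: measurable_funB.
Qed.

Lemma drifted_increment_independent h n : 0 < h ->
  mutually_independent P (fun i : 'I_n => drifted_increment h i).
Proof.
move=> h0 B mB; case: hW => _ indep _ _.
have mC i : measurable [set y | B i (y + delta * h)].
  rewrite -[X in measurable X]setTI.
  by apply: (measurable_funD (f := id) (g := cst (delta * h))).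
have h1 : 0 <= (0%:R : R) * h by rewrite mul0r.
have h2 i : (i < n)%N -> (i%:R : R) * h <= i.+1%:R * h.
  by move=> _; rewrite ler_pM2r// ler_nat.
exact: (indep n (fun k => k%:R * h) h1 h2 _ mC).
Qed.

Lemma drifted_increment_mgf h a k : 0 < h ->
  (\int[P]_w (expR (a * drifted_increment h k w))%:E =
   (expR (a * delta * h + a ^+ 2 * h / 2))%:E)%E.
Proof.
move=> h0; under eq_integral.
  move=> w _; rewrite /drifted_increment mulrDr expRD mulrC EFinM.
  over.
rewrite ge0_integralZl//; last first.
  apply/measurable_EFinP; apply: measurableT_comp => //.
  by apply: measurable_funM => //; exact: measurable_funB.
rewrite brownian_increment_mgf; last 2 first.
- by rewrite mulr_ge0// ltW.
- by rewrite ltr_pM2r// ltr_nat.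
by rewrite -EFinM -expRD -natr1; congr (expR _)%:E; field.
Qed.

(** The nonzero root of [- a * delta + a ^+ 2 / 2], that is, the adjustment coefficient, for which
    the exponential of a drifted increment has mean 1. *)
Let c := 2 * delta.

Let c_gt0 : 0 < c. Proof. by rewrite mulr_gt0. Qed.

Let mgf1 h k : 0 < h ->
  (\int[P]_w (expR (- c * drifted_increment h k w))%:E = 1)%E.
Proof.
move=> h0; rewrite drifted_increment_mgf//.
by rewrite (_ : _ + _ = 0) ?expR0// /c; field.
Qed.

Lemma grid_crossing_le h x n : 0 < h -> 0 < x ->
  (P (~` above (drifted_increment h) x n) <= (expR (- (2 * delta * x)))%:E)%E.
Proof.
move=> h0 x0; apply: crossing_probability_le => //.
- exact: measurable_drifted_increment.
- by move=> k; exact: drifted_increment_independent.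
- by move=> k; exact: mgf1.
Qed.

(** The half exponent [c / 2 = delta] is the minimizer of [- a * delta + a ^+ 2 / 2], with value
    [- delta ^+ 2 / 2]: this is the decay rate in time. *)
Lemma grid_survival_le h x n : 0 < h -> 0 < x -> (0 < n)%N ->
  (survival_mass P (drifted_increment h) c x n <=
   (expR (delta * x - delta ^+ 2 * (n%:R * h) / 2))%:E)%E.
Proof.
move=> h0 x0 n0.
have nh : 0 < n%:R * h by rewrite mulr_gt0 ?ltr0n.
apply: (le_trans (@survival_mass_le _ _ _ P _ c x _ _ n)) => //.
  exact: measurable_drifted_increment.
have -> : c / 2 = delta by rewrite /c; field.
under eq_integral.
  move=> w _; rewrite walk_drifted_increment mulrDr expRD mulrC EFinM.
  over.
rewrite ge0_integralZl//; last first.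
  apply/measurable_EFinP; apply: measurableT_comp => //.
  by apply: measurable_funM => //; exact: measurable_funB.
rewrite brownian_increment_mgf// -!EFinM -!expRD lee_fin ler_expR subr0.
by rewrite le_eqVlt; apply/orP; left; apply/eqP; field.
Qed.

Lemma grid_crossing_ge h x e l n : 0 < h -> 0 < x -> 0 <= l -> (0 < n)%N ->
  1 <= expR (2 * delta * (x + e)) *
       fine (P (~` above (drifted_increment h) x n)) +
     expR (delta * x - delta ^+ 2 * (n%:R * h) / 2) +
     n%:R * expR (2 * delta * x - l * e +
       (- (2 * delta + l) * delta * h + (2 * delta + l) ^+ 2 * h / 2)).
Proof.
move=> h0 x0 l0 n0; rewrite -lee_fin !EFinD EFinM fineK; last first.
  rewrite fin_num_measure//; apply: measurableC; apply: measurable_above => i _.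
  exact: measurable_drifted_increment.
rewrite [expR (2 * delta * x - _ + _)]expRD -[(2 * delta + l) ^+ 2]sqrrN.
apply: (le_trans (@crossing_probability_ge _ _ _ P (drifted_increment h)
  c x _ _ _ _ _ e l _ n _ _)) => //.
- exact: measurable_drifted_increment.
- by move=> k; exact: drifted_increment_independent.
- by move=> k; exact: mgf1.
- by move=> k; exact: drifted_increment_mgf.
- by rewrite leeD2r// leeD2l// grid_survival_le.
Qed.

Lemma grid_crossing_lower_bound (x p : R) : 0 < x ->
  (forall h n, 0 < h -> (P (~` above (drifted_increment h) x n) <= p%:E)%E) ->
  expR (- (2 * delta * x)) <= p.
Proof.
move=> x0 hp.
apply: (@le_of_expR_scale _ (2 * delta)); rewrite ?expR_gt0 ?mulr_gt0//.
move=> e e0.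
suff h1 : 1 <= expR (2 * delta * (x + e)) * p.
  rewrite -(ler_pM2l (expR_gt0 (2 * delta * x))) -expRD subrr expR0.
  by rewrite mulrA -expRD -mulrDr.
apply/ler_addgt0Pr => eta0 eta_gt0.
(* Half of the slack pays for the mass surviving to the horizon, the other half for large
   overshoots. *)
pose eta := eta0 / 2; have eta_pos : 0 < eta by rewrite divr_gt0.
(* Grid of [m ^ 2] steps up to the time [T0], with tilt [l := m]. *)
pose T0 := 2 * expR (delta * x) / (delta ^+ 2 * eta).
have T0_gt0 : 0 < T0 by rewrite divr_gt0 ?mulr_gt0 ?expR_gt0 ?exprn_gt0.
(* [T0] makes [delta ^+ 2 * T0 / 2] equal to [y := expR (delta * x) / eta], and [expR y >= 1 + y]
   suffices. *)
have small1 : expR (delta * x - delta ^+ 2 * T0 / 2) <= eta.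
  have -> : delta ^+ 2 * T0 / 2 = expR (delta * x) / eta.
    by rewrite /T0; field; rewrite !gt_eqF.
  rewrite expRB ler_pdivrMr ?expR_gt0//.
  apply: le_trans (ler_wpM2l (ltW eta_pos) (expR_ge1Dx _)).
  by rewrite mulrDr mulr1 mulrCA divff ?mulr1 ?gt_eqF// lerDr ltW.
(* [K] bounds, uniformly in [m], the overshoot term without its factor [expR (- (m * e))], since
   [2 * delta + m <= m * (2 * delta + 1)]. The cube bound then leaves [27 * K / (e ^+ 3 * m)], which
   the choice of [m] brings below [eta]. *)
pose K := expR (2 * delta * x + (2 * delta + 1) ^+ 2 * T0 / 2).
pose m := (Num.truncn (27 * K / (e ^+ 3 * eta))).+1.
have m_gt : 27 * K / (e ^+ 3 * eta) < m%:R by exact: truncnS_gt.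
have m_gt0 : (0 < m)%N by [].
have m_pos : 0 < m%:R :> R by rewrite ltr0n.
clearbody m.
pose h := T0 / m%:R ^+ 2.
have h_gt0 : 0 < h by rewrite divr_gt0 ?exprn_gt0.
have nh : (m ^ 2)%:R * h = T0.
  by rewrite natrX /h mulrCA divff ?mulr1// gt_eqF// exprn_gt0.
have := @grid_crossing_ge h x e m%:R (m ^ 2) h_gt0 x0 (ltW m_pos).
rewrite expn_gt0 m_gt0 => /(_ isT); rewrite nh => /le_trans; apply.
have -> : eta0 = eta + eta by rewrite /eta -splitr.
rewrite [leRHS]addrA; apply: lerD; first apply: lerD => //.
  rewrite ler_pM2l ?expR_gt0// -lee_fin fineK ?hp//.
  rewrite fin_num_measure//; apply: measurableC; apply: measurable_above => i _.
  exact: measurable_drifted_increment.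
have m1 : 1 <= m%:R :> R by rewrite ler1n.
have E1 : expR (2 * delta * x - m%:R * e +
       (- (2 * delta + m%:R) * delta * h + (2 * delta + m%:R) ^+ 2 * h / 2)) <=
   K / expR (m%:R * e).
  rewrite /K -expRB ler_expR.
  suff : (2 * delta + m%:R) ^+ 2 * h <= (2 * delta + 1) ^+ 2 * T0.
    have : 0 <= (2 * delta + m%:R) * delta * h.
      do 2! [apply: mulr_ge0; last exact: ltW].
      by apply: addr_ge0; rewrite ?mulr_ge0// ltW.
    by lra.
  rewrite -nh natrX mulrA ler_pM2r// -exprMn; apply: lerXn2r.
  - by rewrite nnegrE addr_ge0 ?mulr_ge0// ltW.
  - by rewrite nnegrE mulr_ge0 ?addr_ge0 ?mulr_ge0// ltW.
  - by rewrite [leRHS]mulrDl mul1r lerD2r ler_peMr// mulr_ge0// ltW.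
have me : 0 < m%:R * e by rewrite mulr_gt0.
have cube := expR_ge_cube (ltW me).
apply: (@le_trans _ _ (m%:R ^+ 2 * (K / (m%:R * e / 3) ^+ 3))).
  rewrite natrX ler_pM2l ?exprn_gt0//; apply: (le_trans E1).
  rewrite ler_pM2l ?expR_gt0// lef_pV2 ?posrE ?expR_gt0//.
  by rewrite exprn_gt0// divr_gt0.
have -> : m%:R ^+ 2 * (K / (m%:R * e / 3) ^+ 3) = 27 * K / e ^+ 3 / m%:R.
  by field; rewrite !gt_eqF.
rewrite ler_pdivrMr//.
have -> : 27 * K / e ^+ 3 = eta * (27 * K / (e ^+ 3 * eta)).
  by field; rewrite !gt_eqF.
by rewrite ler_pM2l// ltW.
Qed.

End drifted_increments.

(** * The infimum in continuous time *)

Lemma le_measure_ae d (T : measurableType d) (R : realType)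
    (mu : {measure set T -> \bar R}) (A B : set T) :
  measurable A -> measurable B -> {ae mu, forall w, A w -> B w} ->
  (mu A <= mu B)%E.
Proof.
move=> mA mB [N [mN N0 sub]].
rewrite -[leRHS]adde0 -N0.
apply: (@le_trans _ _ (mu (B `|` N))); last exact: measureU2.
apply: le_measure; rewrite ?inE//; first exact: measurableU.
move=> w Aw; have [Bw|nBw] := pselect (B w); [by left|right].
by apply: sub => /= /(_ Aw).
Qed.

Section infimum.
Context (R : realType) d (T : measurableType d) (P : probability T R).
Variables (W : R -> {RV P >-> R}) (u0 delta : R).
Hypothesis hW : standard_brownian_motion W.
Hypothesis delta_gt0 : 0 < delta.

(* Enumerates the dyadic times; integers that code no pair give time 0. *)
Definition dyadic_time (n : nat) : R :=
  if unpickle n is Some p then (p : nat * nat).1%:R / 2 ^+ p.2 else 0.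

Lemma dyadic_time_ge0 n : 0 <= dyadic_time n.
Proof. by rewrite /dyadic_time; case: unpickle => // p; rewrite divr_ge0. Qed.

Lemma dyadic_time_pickle (k m : nat) :
  dyadic_time (pickle (k, m)) = k%:R / 2 ^+ m.
Proof. by rewrite /dyadic_time pickleK. Qed.

Definition risk t (w : T) : R := u0 + W t w + delta * t.

Lemma measurable_risk t : measurable_fun setT (risk t).
Proof. by apply: measurable_funD => //; exact: measurable_funD. Qed.

(* A measurable version of [infimum_with_drift]. *)
Definition dyadic_infimum (w : T) : \bar R :=
  ereal_inf (range (fun n => (risk (dyadic_time n) w)%:E)).

Lemma measurable_dyadic_infimum : measurable_fun setT dyadic_infimum.
Proof.
pose f n w := (risk (dyadic_time n) w)%:E.
rewrite (_ : dyadic_infimum = fun w => einfs (f ^~ w) 0).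
  apply: measurable_fun_einfs => n; apply/measurable_EFinP.
  exact: measurable_risk.
apply/funext => w; rewrite /dyadic_infimum /einfs/= /sdrop/=; congr ereal_inf.
by apply/seteqP; split => _ [n _ <-]; exists n.
Qed.

Lemma dyadic_dense (t r : R) : 0 <= t -> 0 < r ->
  exists n, `|t - dyadic_time n| < r.
Proof.
move=> t0 r0.
pose m := (Num.truncn r^-1).+1.
have m_gt : r^-1 < 2 ^+ m.
  apply: lt_le_trans (truncnS_gt _) _.
  by rewrite -natrX ler_nat ltnW// ltn_expl.
have p0 : 0 < 2 ^+ m :> R by rewrite exprn_gt0.
pose k := Num.truncn (t * 2 ^+ m).
exists (pickle (k, m)); rewrite dyadic_time_pickle.
have tm0 : 0 <= t * 2 ^+ m by rewrite mulr_ge0// ltW.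
have /andP[k1 k2] := truncn_itv tm0.
have h1 : k%:R / 2 ^+ m <= t by rewrite ler_pdivrMr.
rewrite ger0_norm ?subr_ge0// ltrBlDr -(ltr_pM2r p0) mulrDl divfK ?gt_eqF//.
apply: lt_trans k2 _; rewrite -natr1 addrC ltrD2r.
by rewrite -ltr_pdivrMl// mulr1.
Qed.

Lemma infimum_dyadic w : {within `[0, +oo[, continuous (W ^~ w)} ->
  infimum_with_drift W u0 delta w = dyadic_infimum w.
Proof.
move=> Wc; apply/eqP; rewrite eq_le; apply/andP; split.
  apply: ereal_inf_le_tmp => _ [n _ <-]; exists (dyadic_time n) => //.
  by rewrite /= in_itv/= andbT dyadic_time_ge0.
apply: le_ereal_inf_tmp => x [t /=]; rewrite in_itv/= andbT => t0 <-{x}.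
apply/lee_addgt0Pr => e e0.
have fc : risk ^~ w @ within `[0, +oo[ (nbhs t) --> risk t w.
  apply: cvgD; first apply: cvgD; first exact: cvg_cst.
    have /subspace_continuousP := Wc; apply.
    by rewrite /= in_itv/= andbT.
  apply: cvgM; first exact: cvg_cst.
  by apply: cvg_within_filter; exact: cvg_id.
have /cvgrPdist_lt/(_ _ e0) := fc.
rewrite near_withinE => /nbhs_ballP[r /= r0 hr].
have [n hn] := dyadic_dense t0 r0.
apply: (@le_trans _ _ (risk (dyadic_time n) w)%:E).
  by apply: ereal_inf_lbound; exists n.
have := hr _ hn; rewrite in_itv/= andbT dyadic_time_ge0 => /(_ isT).
rewrite -EFinD lee_fin ltr_distl => /andP[h _].
by apply: ltW; rewrite -/(risk t w); lra.
Qed.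

Lemma ae_infimum_dyadic :
  {ae P, forall w, infimum_with_drift W u0 delta w = dyadic_infimum w}.
Proof.
case: hW => _ _ _; apply: filterS => w; exact: infimum_dyadic.
Qed.

(** Taking [4 ^ m] steps of length [2 ^ - m] reaches the horizon [2 ^ m]: the grids are nested,
    refine and extend all at once. *)
Definition dyadic_below v (m : nat) : set T :=
  \bigcup_(k in [set k | (k <= 4 ^ m)%N]) [set w | risk (k%:R / 2 ^+ m) w < v].

Lemma measurable_dyadic_below v m : measurable (dyadic_below v m).
Proof.
apply: bigcup_measurable => k _; rewrite -[X in measurable X]setTI.
rewrite (_ : [set w | _] = risk (k%:R / 2 ^+ m) @^-1` `]-oo, v[).
  exact: measurable_risk.
by apply/seteqP; split => w /=; rewrite in_itv.
Qed.

Lemma dyadic_below_nondecreasing v : nondecreasing_seq (dyadic_below v).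
Proof.
apply/nondecreasing_seqP => m; apply/subsetPset => w [k /= km kv].
exists (2 * k)%N => /=.
  rewrite expnS (@leq_trans (2 * 4 ^ m))// ?leq_mul//.
by rewrite (_ : _ / _ = k%:R / 2 ^+ m)// natrM exprS; field; rewrite expf_neq0.
Qed.

(** Strictness matters: an infimum below [v] is witnessed at one time, while an infimum equal to [v]
    need not be attained. *)
Lemma dyadic_infimum_lt v :
  [set w | (dyadic_infimum w < v%:E)%E] = \bigcup_m dyadic_below v m.
Proof.
apply/seteqP; split => w /=.
  move=> /ereal_inf_lt[_ [n _ <-]]; rewrite lte_fin /dyadic_time.
  case: unpickle => [[k m]|] /= h; last first.
    by exists 0%N => //; exists 0%N => //=; rewrite mul0r.
  (* The time [k / 2 ^ m] may lie beyond the horizon of level [m]; raising the level by [k] brings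
     it inside. *)
  exists (k + m)%N => //; exists (k * 2 ^ k)%N => /=.
    rewrite expnD; apply: (@leq_trans (2 ^ k * 2 ^ k)%N).
      by rewrite leq_mul// ltnW// ltn_expl.
    by rewrite -expnMn leq_pmulr// expn_gt0.
  rewrite (_ : _ / _ = k%:R / 2 ^+ m)// natrM natrX exprD.
  by field; rewrite !expf_neq0.
move=> [m _ [k _ /= kv]].
apply: (@le_lt_trans _ _ (risk (k%:R / 2 ^+ m) w)%:E); last by rewrite lte_fin.
by apply: ereal_inf_lbound; exists (pickle (k, m)) => //; rewrite dyadic_time_pickle.
Qed.

Let mle v : measurable [set w | (dyadic_infimum w <= v%:E)%E].
Proof.
have := emeasurable_fun_infty_c measurableT measurable_dyadic_infimum v%:E.
by rewrite setTI.
Qed.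

Let mlt v : measurable [set w | (dyadic_infimum w < v%:E)%E].
Proof.
have := emeasurable_fun_infty_o measurableT measurable_dyadic_infimum v%:E.
by rewrite setTI.
Qed.

Let mabove h x n : measurable (~` above (drifted_increment W delta h) x n).
Proof.
apply: measurableC; apply: measurable_above => i _.
exact: measurable_drifted_increment.
Qed.

Let not_above h x n w : W 0 w = 0 ->
  (~` above (drifted_increment W delta h) x n) w <->
  exists2 j, (j <= n)%N & risk (j%:R * h) w <= u0 - x.
Proof.
move=> W0; split => [/existsNP[j /not_implyP[jn /negP]]|[j jn hj] /(_ j jn)].
  rewrite -leNgt walk_drifted_increment W0 subr0 => hj; exists j => //.
  by rewrite /risk; lra.
rewrite walk_drifted_increment W0 subr0 ltNge; apply/negP; rewrite negbK.
by rewrite /risk in hj; lra.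
Qed.

Let prob_lt_le v : v < u0 ->
  (P [set w | (dyadic_infimum w < v%:E)%E] <=
   (expR (- (2 * delta * (u0 - v))))%:E)%E.
Proof.
move=> vu; rewrite dyadic_infimum_lt.
have mU : measurable (\bigcup_m dyadic_below v m).
  by apply: bigcup_measurable => m _; exact: measurable_dyadic_below.
have := nondecreasing_cvg_mu (mu := P) (measurable_dyadic_below v) mU
  (@dyadic_below_nondecreasing v).
apply: cvge_le; apply: nearW => m /=.
have h0 : 0 < (2 ^+ m)^-1 :> R by rewrite invr_gt0 exprn_gt0.
have x0 : 0 < u0 - v by rewrite subr_gt0.
apply: le_trans (grid_crossing_le hW delta_gt0 (4 ^ m) h0 x0).
apply: le_measure_ae => //; first exact: measurable_dyadic_below.
case: hW => W0 _ _ _; apply: filterS W0 => w W0 [k /= km kv].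
by apply/(not_above _ _ _ W0); exists k => //; rewrite subKr ltW.
Qed.

(** A crossing on any grid forces the infimum to be at most [v], so this probability is an
    admissible uniform bound in [grid_crossing_lower_bound]. *)
Let prob_le_ge v : v < u0 ->
  ((expR (- (2 * delta * (u0 - v))))%:E <=
   P [set w | (dyadic_infimum w <= v%:E)%E])%E.
Proof.
move=> vu; have x0 : 0 < u0 - v by rewrite subr_gt0.
rewrite -[leRHS]fineK ?fin_num_measure// lee_fin.
apply: (grid_crossing_lower_bound hW delta_gt0 x0) => h n h0.
rewrite fineK ?fin_num_measure//; apply: le_measure_ae => //.
case: hW => W0 _ _ Wc; apply: filterS2 W0 Wc => w W0 Wc.
move=> /(not_above _ _ _ W0)[j _]; rewrite subKr => hj /=.
rewrite -infimum_dyadic//; apply: ge_ereal_inf.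
exists (risk (j%:R * h) w)%:E; last by rewrite lee_fin.
exists (j%:R * h) => //=.
by rewrite in_itv/= andbT mulr_ge0// ltW.
Qed.

Let a_gt0 : 0 < 2 * delta. Proof. by rewrite mulr_gt0. Qed.

(** The lower bound is known only for the non-strict event; it is used at level [v - e], inside the
    strict event at [v], and [e] tends to 0. *)
Lemma dyadic_infimum_prob_lt v : v <= u0 ->
  P [set w | (dyadic_infimum w < v%:E)%E] =
  (expR (- (2 * delta * (u0 - v))))%:E.
Proof.
move=> vu; apply/eqP; rewrite eq_le; apply/andP; split.
  have := vu; rewrite [v <= u0]le_eqVlt => /orP[/eqP->|]; last exact: prob_lt_le.
  by rewrite subrr mulr0 oppr0 expR0 probability_le1.
rewrite -[leRHS]fineK ?fin_num_measure// lee_fin.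
apply: (le_of_expR_scale a_gt0); first exact: expR_gt0.
move=> e e0; have veu : v - e < u0 by apply: lt_le_trans vu; rewrite ltrBlDr ltrDl.
rewrite -ler_pdivrMl ?expR_gt0// -expRN -expRD -lee_fin.
rewrite fineK ?fin_num_measure//.
rewrite (_ : _ + _ = - (2 * delta * (u0 - (v - e)))); last by ring.
apply: le_trans (prob_le_ge veu) _; apply: le_measure; rewrite ?inE//.
by move=> w /= /le_lt_trans; apply; rewrite lte_fin ltrBlDr ltrDl.
Qed.

Lemma dyadic_infimum_prob_le v : v <= u0 ->
  P [set w | (dyadic_infimum w <= v%:E)%E] =
  (expR (- (2 * delta * (u0 - v))))%:E.
Proof.
move=> vu; apply/eqP; rewrite eq_le; apply/andP; split; last first.
  rewrite -dyadic_infimum_prob_lt//; apply: le_measure; rewrite ?inE//.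
  by move=> w /= /ltW.
set p := P _; have pK : p = (fine p)%:E by rewrite fineK// fin_num_measure.
rewrite pK lee_fin.
have [p0|p0] := leP (fine p) 0; first exact: le_trans p0 (expR_ge0 _).
apply: (le_of_expR_scale a_gt0 p0) => e e0.
rewrite -expRD (_ : _ + _ = - (2 * delta * (u0 - (v + e)))); last by ring.
(* The strict law applies at [v + e] only up to [u0]; beyond, the claimed bound is at least 1. *)
have [veu|uve] := leP (v + e) u0; last first.
  apply: (@le_trans _ _ 1); first by rewrite -lee_fin -pK probability_le1.
  by rewrite -[leLHS]expR0 ler_expR oppr_ge0 mulr_ge0_le0 ?subr_le0 ?ltW.
rewrite -lee_fin -pK -dyadic_infimum_prob_lt//.
apply: le_measure; rewrite ?inE//.
by move=> w /= /le_lt_trans; apply; rewrite lte_fin ltrDl.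
Qed.

End infimum.

(** * The capital requirement *)

(** A zero second moment would make [X] vanish almost everywhere, hence have mean 0. *)
Lemma second_moment_gt0 (R : realType) d (T : measurableType d)
    (Q : probability T R) (X : {RV Q >-> R}) (mu m2 : R) :
  'E_Q[X]%E = mu%:E -> 'E_Q[fun w => (X w ^+ 2)%R]%E = m2%:E -> mu != 0 ->
  0 < m2.
Proof.
rewrite !expectation.unlock => hmu hm2 mu0.
have m2_ge0 : 0 <= m2.
  by rewrite -lee_fin -hm2; apply: integral_ge0 => w _; rewrite lee_fin sqr_ge0.
rewrite lt_neqAle m2_ge0 andbT eq_sym; apply: contra_neq mu0 => m20.
have mX2 : measurable_fun setT (fun w => (X w ^+ 2)%:E).
  by apply/measurable_EFinP; exact: measurable_funX.
have : (\int[Q]_w `|(X w ^+ 2)%:E| = 0)%E.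
  transitivity m2%:E; last by rewrite m20.
  rewrite -hm2; apply: eq_integral => w _.
  by rewrite gee0_abs// lee_fin sqr_ge0.
move/(ae_eq_integral_abs Q measurableT mX2) => X0.
have : (\int[Q]_w (X w)%:E = \int[Q]_w cst 0 w)%E.
  apply: ae_eq_integralT; apply: filterS X0 => w /(_ I) [/eqP].
  by rewrite sqrf_eq0 => /eqP ->.
by rewrite hmu integral0 => -[].
Qed.

Lemma integral_expR_tail (R : realType) (a b : R) : 0 < a ->
  (\int[lebesgue_measure]_(r in `[0%R, +oo[) (expR (- (a * (b + r))))%:E =
   (expR (- (a * b)) / a)%:E)%E.
Proof.
move=> a0.
(* The integrand is a multiple of the exponential density of rate [a], whose total mass is 1. *)
transitivity (\int[lebesgue_measure]_r
    ((expR (- (a * b)) / a)%:E * (exponential_pdf a r)%:E))%E.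
  rewrite integral_mkcond; apply: eq_integral => r _.
  rewrite /exponential_pdf !patchE; case: ifPn => _; last by rewrite mule0.
  rewrite -EFinM; congr EFin; rewrite mulrA divfK ?gt_eqF// -expRD.
  by congr expR; ring.
rewrite ge0_integralZl//.
- by rewrite integral_exponential_pdf// mule1.
- by apply/measurable_EFinP; exact: measurable_exponential_pdf.
- by move=> r _; rewrite lee_fin exponential_pdf_ge0// ltW.
- by rewrite lee_fin divr_ge0 ?expR_ge0// ltW.
Qed.

Section conditional_infimum.
Context (R : realType) d (T : measurableType d) (P : probability T R).
Variables (W : R -> {RV P >-> R}) (u0 delta v : R).
Hypothesis hW : standard_brownian_motion W.
Hypotheses (delta_gt0 : 0 < delta) (vu : v <= u0).

Let Z := dyadic_infimum W u0 delta.
Let a := 2 * delta.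
Let p := expR (- (a * (u0 - v))).

Let a_gt0 : 0 < a. Proof. by rewrite mulr_gt0. Qed.

Let mZ : measurable_fun setT Z.
Proof. exact: measurable_dyadic_infimum. Qed.

Let mle r : measurable [set w | (Z w <= r%:E)%E].
Proof. by have := emeasurable_fun_infty_c measurableT mZ r%:E; rewrite setTI. Qed.

Let mlt r : measurable [set w | (Z w < r%:E)%E].
Proof. by have := emeasurable_fun_infty_o measurableT mZ r%:E; rewrite setTI. Qed.

Lemma ae_dyadic_infimum_fin_num : {ae P, forall w, Z w \is a fin_num}.
Proof.
have mN : measurable [set w | Z w = -oo%E].
  rewrite -[X in measurable X]setTI.
  by apply: (mZ measurableT (Y := [set -oo%E])); exact: emeasurable_set1.
exists [set w | Z w = -oo%E]; split => //; last first.
  move=> w /= /negP; rewrite fin_numE negb_and !negbK => /orP[/eqP//|/eqP Zy].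
  have : (Z w <= (risk W u0 delta (dyadic_time R 0) w)%:E)%E.
    by apply: ereal_inf_lbound; exists 0%N.
  by rewrite Zy.
set q := P _; have qK : q = (fine q)%:E by rewrite fineK// fin_num_measure.
apply/eqP; rewrite eq_le measure_ge0 andbT qK lee_fin leNgt; apply/negP => q0.
have qle x : 0 <= x -> fine q <= expR (- x).
  move=> x0; rewrite -lee_fin -qK.
  have xu : u0 - x / a <= u0 by rewrite lerBlDr lerDl divr_ge0// ltW.
  have -> : x = 2 * delta * (u0 - (u0 - x / a)).
    by rewrite -/a subKr mulrC divfK// gt_eqF.
  rewrite -(dyadic_infimum_prob_lt hW delta_gt0 xu).
  by apply: le_measure; rewrite ?inE// => w /= Zw; rewrite -/(Z w) Zw ltNyr.
(* The bound by [expR (- x)] already fails at [x = 1 / q], because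
   [expR (1 / q) >= 1 + 1 / q > 1 / q]. *)
have iq : 0 <= (fine q)^-1 by rewrite invr_ge0 ltW.
have := qle _ iq; rewrite leNgt => /negP; apply.
rewrite expRN -[ltRHS]invrK ltf_pV2 ?posrE ?expR_gt0 ?invr_gt0//.
by apply: lt_le_trans (expR_ge1Dx _); rewrite ltrDr.
Qed.

(** The depth below [v], cut off at 0 so that it also encodes the event [Z <= v]; the value 0 of
    [fine] at infinity matters only on a null set. *)
Let D (w : T) : R := Num.max 0 (v - fine (Z w)).

Let mD : measurable_fun setT D.
Proof.
apply: measurable_maxr => //; apply: measurable_funB => //.
exact: measurableT_comp.
Qed.

(** The mean is the integral of the tail: for [r >= 0], up to a null set, [D > r] is the event
    [Z < v - r], whose probability is known. *)
Lemma integral_depth : (\int[P]_w (D w)%:E = (p / a)%:E)%E.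
Proof.
pose X : {RV P >-> R} := HB.pack D (isMeasurableFun.Build _ _ _ _ _ mD).
have -> : (\int[P]_w (D w)%:E)%E = 'E_P[X]%E by rewrite expectation.unlock.
rewrite ge0_expectation_ccdf; last by move=> w; rewrite /= /D le_max lexx.
rewrite -integral_expR_tail//; apply: eq_integral => r.
rewrite inE /= in_itv/= andbT => r0.
have vru : v - r <= u0 by apply: le_trans vu; rewrite lerBlDr lerDl.
rewrite (_ : u0 - v + r = u0 - (v - r)); last by ring.
rewrite -(dyadic_infimum_prob_lt hW delta_gt0 vru).
have mX : measurable (X @^-1` `]r, +oo[).
  by rewrite -[X in measurable X]setTI; exact: mD.
have XZ w : Z w \is a fin_num ->
    (X @^-1` `]r, +oo[) w <-> [set w | (Z w < (v - r)%:E)%E] w.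
  move=> Zw; rewrite /= in_itv/= andbT /D lt_max ltNge r0/=.
  by rewrite -(fineK Zw) lte_fin; split; lra.
apply/eqP; rewrite eq_le; apply/andP; split.
  apply: (le_measure_ae mX (mlt (v - r))).
  by apply: filterS ae_dyadic_infimum_fin_num => w /XZ[].
apply: (le_measure_ae (mlt (v - r)) mX).
by apply: filterS ae_dyadic_infimum_fin_num => w /XZ[].
Qed.

Lemma capital_requirementE :
  capital_requirement W u0 delta v = (- v + (2 * delta)^-1)%:E.
Proof.
have p_gt0 : 0 < p by exact: expR_gt0.
rewrite /capital_requirement /event_cond_expectation.
pose A := [set w | (Z w <= v%:E)%E].
have mA : measurable A by exact: mle.
have PA : P A = p%:E by exact: dyadic_infimum_prob_le.
have -> : ('E_P[\1_[set w | (infimum_with_drift W u0 delta w <= v%:E)%E]] = p%:E)%E.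
  transitivity 'E_P[\1_A]%E; last by rewrite expectation_indic.
  rewrite !expectation.unlock.
  apply: ae_eq_integralT; apply: filterS (ae_infimum_dyadic u0 delta hW) => w h.
  by rewrite !indicE; congr (_ (nat_of_bool _))%:E; apply/idP/idP;
    rewrite !inE /A/= -/(Z w) h.
have -> : (\int[P]_(w in [set w | (infimum_with_drift W u0 delta w <= v%:E)%E])
    infimum_with_drift W u0 delta w = (v * p - p / a)%:E)%E.
  rewrite integral_mkcond.
  (* On [A] the infimum is [v - D], and off [A] both terms vanish. The numerator is thus
     [p * (v - 1 / a)]; dividing by [p] removes the only trace of [u0]. *)
  transitivity (\int[P]_w ((v * \1_A w)%:E - (D w)%:E))%E.
    apply: ae_eq_integralT.
    apply: filterS2 (ae_infimum_dyadic u0 delta hW) ae_dyadic_infimum_fin_num => w h Zw.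
    rewrite patchE /D indicE.
    have [Av|Av] := pselect (A w).
      rewrite !mem_set//=; last by rewrite h.
      have : fine (Z w) <= v by rewrite -lee_fin fineK.
      rewrite -subr_ge0 => /max_idPr ->.
      by rewrite h -/(Z w) -[LHS](fineK Zw) mulr1 -EFinB subKr.
    rewrite !memNset//=; last by rewrite h.
    have : v - fine (Z w) <= 0.
      by rewrite subr_le0 -lee_fin fineK// ltW// ltNge; exact/negP.
    by move=> /max_idPl ->; rewrite mulr0 sube0.
  have iA : P.-integrable setT (fun w => (\1_A w)%:E).
    exact: integrable_indic.
  have I1 : (\int[P]_w (\1_A w)%:E = p%:E)%E.
    by rewrite integral_indic// setIT; exact: PA.
  rewrite integralB_EFin//.
  - rewrite integral_depth; under eq_integral do rewrite EFinM.
    by rewrite integralZl// I1.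
  - apply: (eq_integrable _ (fun w => v%:E * (\1_A w)%:E)%E) => //.
    exact: integrableZl.
  - apply/integrableP; split; first exact/measurable_EFinP.
    under eq_integral => w _.
      rewrite /= ger0_norm; last by rewrite /D le_max lexx.
      over.
    by rewrite integral_depth ltry.
rewrite inver gt_eqF// -EFinM -EFinN; congr EFin.
by rewrite -/a; field; rewrite !gt_eqF.
Qed.

End conditional_infimum.

(** The levels satisfy [v <= u / m2], the starting point. Above it the conditioning event is almost
    sure, and the capital would be [- u / m2 + m2 / (2 * rho * mu)], which depends on [u]. *)
Theorem theorem18 (R : realType)
    (d' : measure_display) (T' : measurableType d') (Q : probability T' R)
    (X : {RV Q >-> R}) (mu m2 : R)
    (hmu : 'E_Q[X]%E = mu%:E) (hm2 : 'E_Q[fun w => (X w ^+ 2)%R]%E = m2%:E) (mu_gt0 : 0 < mu)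
    (rho : R) (rho_gt0 : 0 < rho)
    (d : measure_display) (T : measurableType d) (P : probability T R)
    (W : R -> {RV P >-> R}) (hW : standard_brownian_motion W) :
  let delta := rho * (mu / m2) in
  let kappa (u v : R) := capital_requirement W (u / m2) delta v in
  (forall u1 u2 v : R, 0 < u1 -> 0 < u2 -> v <= u1 / m2 -> v <= u2 / m2 ->
     kappa u1 v = kappa u2 v) /\
  (forall u v : R, 0 < u -> v <= u / m2 ->
     kappa u v = (- v + m2 / (2 * rho * mu))%:E).
Proof.
have m2_gt0 : 0 < m2 by apply: (second_moment_gt0 hmu hm2); rewrite gt_eqF.
have delta_gt0 : 0 < rho * (mu / m2) by rewrite !mulr_gt0 ?invr_gt0.
split=> [u1 u2 v _ _ vu1 vu2|u v _ vu]; rewrite !capital_requirementE//.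
by congr (_ + _)%:E; field; rewrite !gt_eqF.
Qed.
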